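(* Let $1\le j<k$, let $p_1,\dots,p_k$ be distinct primes, and let $G=S_{p_1}\times\cdots\times S_{p_j}\times\mathbb{Z}_s$, where $S_{p_i}=\mathbb{Z}_{p_i^{e_i}}\times\mathbb{Z}_{p_i^{t_i}}$ with $1\le t_i\le e_i$ for $1\le i\le j$, and $s=p_{j+1}^{e_{j+1}}\cdots p_k^{e_k}$ with $e_{j+1},\dots,e_k\ge1$. Let $x=(a_1,a_2,\ldots,a_j,a_s)$ and $y=(b_1,b_2,\ldots,b_j,b_s)$ be two elements of $G$, with $a_i,b_i\in S_{p_i}$ and $a_s,b_s\in\mathbb{Z}_s$. Then $\langle x,y\rangle=G$ if and only if $\langle a_i,b_i\rangle=S_{p_i}$ for all $1\le i\le j$ and $\langle a_s,b_s\rangle=\mathbb{Z}_s$.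
   Context: Groups are finite abelian groups under componentwise addition; $\mathbb{Z}_n$ is the cyclic group of integers modulo $n$; $\langle x,y\rangle$ is the subgroup generated by $x$ and $y$. *)

(* Defs.v *)
From HB Require Import structures.
From mathcomp Require Import all_boot all_order all_fingroup all_algebra.

Set Implicit Arguments.
Unset Strict Implicit.
Unset Printing Implicit Defensive.

Local Open Scope group_scope.

(* The group law of the finGroupType 'Z_n is addition mod n, and the group laws
   of binary products and of {dffun forall i, _} are componentwise, so << _ >>
   below is additive generation. 'Z_n has n elements only when n > 1. *)

Definition primary2 (q e t : nat) : finGroupType :=
  ('Z_(q ^ e)%N * 'Z_(q ^ t)%N)%type.

Section TheGroup.

Variables (j k : nat) (ltjk : j < k) (p e : 'I_k -> nat) (t : 'I_j -> nat).

Definition emb (i : 'I_j) : 'I_k := widen_ord (ltnW ltjk) i.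

Definition Sp (i : 'I_j) : finGroupType := primary2 (p (emb i)) (e (emb i)) (t i).

Definition cyc_order : nat := (\prod_(i < k | j <= i) p i ^ e i)%N.

Definition bigG : finGroupType :=
  ({dffun forall i : 'I_j, Sp i} * 'Z_cyc_order)%type.

End TheGroup.

(* Main.v *)
(** Each factor of [G] that is the image of [H := <<x, y>>] under a coordinate
    projection has order dividing [#|H|]. The factors have pairwise coprime
    orders, so if all the projections are onto then [#|G|] divides [#|H|],
    hence [H = G]. The converse holds because projections map generators to
    generators. *)

Require Import Defs.
From HB Require Import structures.
From mathcomp Require Import all_boot all_order all_fingroup all_algebra.

Set Implicit Arguments.
Unset Strict Implicit.
Unset Printing Implicit Defensive.

Local Open Scope group_scope.

Lemma gen2_image (aT rT : finGroupType) (f : {morphism [set: aT] >-> rT})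
    (x y : aT) : f @* <<[set x; y]>> = <<[set f x; f y]>>.
Proof.
by rewrite morphim_gen ?subsetT// morphimEsub ?subsetT// imsetU1 imset_set1.
Qed.

(** The map [g] need not be a morphism: as a set-theoretic section it makes [f] onto. *)
Lemma gen2_full_image (aT rT : finGroupType) (f : {morphism [set: aT] >-> rT})
    (g : rT -> aT) (x y : aT) : cancel g f ->
  <<[set x; y]>> = [set: aT] -> <<[set f x; f y]>> = [set: rT].
Proof.
move=> gK xyT; rewrite -gen2_image xyT; apply/setP=> z; rewrite inE.
by apply/morphimP; exists (g z); rewrite ?inE.
Qed.

Lemma dvdn_card_gen2 (aT rT : finGroupType) (f : {morphism [set: aT] >-> rT})
    (x y : aT) :
  <<[set f x; f y]>> = [set: rT] -> #|rT| %| #|<<[set x; y]>>|.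
Proof. by rewrite -cardsT => <-; rewrite -gen2_image dvdn_morphim. Qed.

(** Coprimality is asked only for members of [r], so that the lemma applies to the tail of a
    duplicate-free list, whose entries all differ from the head. *)
Lemma coprime_bigprod (I : eqType) (r : seq I) (P : pred I)
    (F : I -> nat) (m : nat) :
  (forall i, i \in r -> P i -> coprime m (F i)) ->
  coprime m (\prod_(i <- r | P i) F i)%N.
Proof.
move=> co; rewrite big_seq_cond; elim/big_ind: _ => [|u v cu cv|i /andP[]].
- exact: coprimen1.
- by rewrite coprimeMr cu.
- exact: co.
Qed.

Lemma bigprod_dvdn (I : finType) (F : I -> nat) (n : nat) :
  (forall i i', i != i' -> coprime (F i) (F i')) -> (forall i, F i %| n) ->
  (\prod_i F i %| n)%N.
Proof.
move=> co dv; elim: (index_enum I) (index_enum_uniq I) => [|i r IH] /=.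
  by rewrite big_nil dvd1n.
case/andP=> ri ur; rewrite big_cons Gauss_dvd ?dv ?IH//.
by apply: coprime_bigprod => i' ri' _; apply: co; apply: contraNneq ri => ->.
Qed.

Lemma card_Zn (n : nat) : 1 < n -> #|'Z_n| = n.
Proof. by move=> n1; rewrite card_ord Zp_cast. Qed.

Lemma card_primary2 (q e t : nat) : 1 < q -> 0 < e -> 0 < t ->
  #|primary2 q e t| = (q ^ (e + t))%N.
Proof.
move=> q1 e0 t0; rewrite card_prod !card_Zn ?expnD//.
  by rewrite -(exp1n t) ltn_exp2r.
by rewrite -(exp1n e) ltn_exp2r.
Qed.

Theorem theorem3p7 (j k : nat) (j_ge1 : 1 <= j) (ltjk : j < k)
    (p e : 'I_k -> nat) (t : 'I_j -> nat)
    (p_prime : forall i : 'I_k, prime (p i))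
    (p_inj : injective p)
    (t_e : forall i : 'I_j, 1 <= t i <= e (emb ltjk i))
    (e_ge1 : forall i : 'I_k, j <= i -> 1 <= e i)
    (a b : {dffun forall i : 'I_j, Sp ltjk p e t i})
    (a_s b_s : 'Z_(cyc_order j p e)) :
  let x : bigG ltjk p e t := (a, a_s) in
  let y : bigG ltjk p e t := (b, b_s) in
  <<[set x; y]>> = [set: bigG ltjk p e t] <->
  (forall i : 'I_j, <<[set a i; b i]>> = [set: Sp ltjk p e t i]) /\
  <<[set a_s; b_s]>> = [set: 'Z_(cyc_order j p e)].
Proof.
move=> x y.
pose D : finGroupType := {dffun forall i, Sp ltjk p e t i}.
pose fst_mor := [morphism of @fst D 'Z_(cyc_order j p e)].
pose snd_mor := [morphism of @snd D 'Z_(cyc_order j p e)].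
split=> [xyT | [abT abs]].
  have abT : <<[set a; b]>> = setT.
    exact: (@gen2_full_image _ _ fst_mor (fun u => (u, 1)) x y).
  split=> [i|].
    (* The section of evaluation at [i] sends [u] to the family equal to [u] at [i] and trivial
       elsewhere. *)
    apply: (@gen2_full_image _ _ (@dffun_morphism _ _ i) (@dfung1 _ _ i) a b) => //.
    by move=> u; rewrite /= /dfung1 ffunE dfwith_in.
  exact: (@gen2_full_image _ _ snd_mor (fun u => (1, u)) x y).
have p1 i : 1 < p i by exact: prime_gt1.
have co i i' m n : i != i' -> coprime (p i ^ m) (p i' ^ n).
  move=> ii'; apply/coprimeXl/coprimeXr.
  by rewrite prime_coprime// dvdn_prime2// (inj_eq p_inj).
have cardS i : #|Sp ltjk p e t i| = (p (emb ltjk i) ^ (e (emb ltjk i) + t i))%N.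
  by case/andP: (t_e i) => t0 te; rewrite card_primary2// (leq_trans t0).
(* Since [j < k], the index [j] itself contributes a factor [p ^ e > 1]. This excludes the
   degenerate ['Z_1], which has two elements. *)
have cyc_gt1 : 1 < cyc_order j p e.
  rewrite /cyc_order (bigD1 (Ordinal ltjk))//=.
  apply: (@leq_trans (p (Ordinal ltjk) ^ e (Ordinal ltjk))%N).
    by rewrite -(exp1n (e (Ordinal ltjk))) ltn_exp2r ?e_ge1.
  by rewrite leq_pmulr// prodn_gt0// => i; rewrite expn_gt0 ltnW.
have cardD : #|D| = (\prod_i #|Sp ltjk p e t i|)%N.
  by rewrite card_dep_ffun foldrE big_image.
have coS : coprime #|D| #|'Z_(cyc_order j p e)|.
  rewrite card_Zn// cardD; apply: coprime_bigprod => i' _ ji'.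
  rewrite coprime_sym; apply: coprime_bigprod => i _ _; rewrite cardS co//.
  (* The indices differ because [emb ltjk i] has value below [j], while [j <= i']. *)
  by apply: contraTneq ji' => ->; rewrite -ltnNge /= ltn_ord.
apply/eqP; rewrite eqEcard subsetT/= cardsT.
apply: dvdn_leq => //; rewrite card_prod Gauss_dvd//.
rewrite (dvdn_card_gen2 (f := snd_mor))// andbT.
(* Divisibility passes through the first projection, leaving [#|D|] to divide the order of
   [<<[set a; b]>>]; this is checked one factor of [D] at a time. *)
apply: dvdn_trans (dvdn_morphim fst_mor _).
rewrite gen2_image cardD bigprod_dvdn// => [i i' ii'|i].
  by rewrite !cardS co// (inj_eq (@widen_ord_inj _ _ _)).
exact: (dvdn_card_gen2 (f := dffun_morphism _ i)).
Qed.
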